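(* For all non-negative integers $m$ and $n$, $$s_{((2m)^n)}(x_1,x_1^{-1},x_2,x_2^{-1},\dots,x_n,x_n^{-1})=(-1)^{mn}\,\mathrm{so}_{(m^n)}(x_1,x_2,\dots,x_n)\;\mathrm{so}_{(m^n)}(-x_1,-x_2,\dots,-x_n),$$ as an identity of Laurent polynomials in the indeterminates $x_1,\dots,x_n$.
   Context: For integers $M,k\ge 0$, $(M^k)$ denotes the sequence $(M,M,\dots,M)$ with $k$ entries; a partition is padded with zeros to the number of variables when needed. Schur function: for a partition $\lambda=(\lambda_1\ge\dots\ge\lambda_N\ge 0)$, $$s_\lambda(x_1,\dots,x_N)=\frac{\det_{1\le h,t\le N}\left(x_h^{\lambda_t+N-t}\right)}{\det_{1\le h,t\le N}\left(x_h^{N-t}\right)}.$$ It is a polynomial in $x_1,\dots,x_N$. On the left-hand side of the claim it is taken in $2n$ variables ($N=2n$), specialized to $x_1,x_1^{-1},\dots,x_n,x_n^{-1}$. Odd orthogonal character: for a non-increasing sequence $\lambda=(\lambda_1,\dots,\lambda_N)$ of non-negative integers, $$\mathrm{so}_\lambda(x_1,\dots,x_N)=\frac{\det_{1\le h,t\le N}\left(x_h^{\lambda_t+N-t+\frac12}-x_h^{-(\lambda_t+N-t+\frac12)}\right)}{\det_{1\le h,t\le N}\left(x_h^{N-t+\frac12}-x_h^{-(N-t+\frac12)}\right)}.$$ It is a Laurent polynomial in $x_1,\dots,x_N$; $\mathrm{so}_\lambda(-x_1,\dots,-x_N)$ denotes the result of substituting $-x_i$ for $x_i$ in this Laurent polynomial.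 Determinants of $0\times 0$ matrices equal $1$. *)

(* Defs.v *)
From HB Require Import structures.
From mathcomp Require Import all_boot all_order perm all_algebra.
From mathcomp Require Import fraction.
From mathcomp.multinomials Require Import mpoly.

Set Implicit Arguments.
Unset Strict Implicit.
Unset Printing Implicit Defensive.

Import GRing.Theory.
Local Open Scope ring_scope.

(* Laurent polynomials in x_1, ..., x_n are identified with their images in    *)
(* the field of rational functions Frac(Z[x_1, ..., x_n]), which contains the  *)
(* Laurent polynomial ring Z[x_1^{+-1}, ..., x_n^{+-1}].                       *)
Notation ratfun n := {fraction {mpoly int[n]}}.

Definition xvar (n : nat) (i : 'I_n) : ratfun n := tofrac 'X_i.

(* Substitution of the polynomials q_i for the x_i in a rational function,     *)
(* computed on a representative fraction. This is a field morphism,            *)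
(* independent of the representative, as soon as substituting the q_i is       *)
(* injective on polynomials; it is only used in the two cases below.           *)
Definition fsubst (n : nat) (q : n.-tuple {mpoly int[n]}) (f : ratfun n) :
    ratfun n :=
  tofrac (\n_(repr f) \mPo q) / tofrac (\d_(repr f) \mPo q).

Definition subst_sq (n : nat) : ratfun n -> ratfun n :=
  fsubst [tuple 'X_i ^+ 2 | i < n].

Definition subst_opp (n : nat) : ratfun n -> ratfun n :=
  fsubst [tuple - 'X_i | i < n].

(* Indices are 0-based: the index t in 'I_N stands for the 1-based t.+1, and   *)
(* the nth-with-default-0 access lam`_t pads lam with zeros. The bialternant   *)
(* formula gives the value of the Schur polynomial at any x_1, ..., x_N that   *)
(* are pairwise distinct, i.e., at which the denominator does not vanish.      *)
Definition schur (F : fieldType) (N : nat) (lam : seq nat) (x : 'I_N -> F) : F :=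
  \det (\matrix_(h < N, t < N) x h ^+ (nth 0%N lam t + (N - t.+1)))
    / \det (\matrix_(h < N, t < N) x h ^+ (N - t.+1)).

(* The quotient defining so_lam(x_1, ..., x_N), with the half-integer powers   *)
(* x_h^{k + 1/2} cleared by renaming the variable x_h^{1/2} into x_h: this is  *)
(* so_lam(x_1^2, ..., x_N^2), and k + 1/2 becomes 2 k + 1.                     *)
Definition so_quotient (N : nat) (lam : seq nat) : ratfun N :=
  \det (\matrix_(h < N, t < N)
          let k := (nth 0%N lam t + (N - t.+1))%N in
          xvar h ^+ (2 * k + 1) - xvar h ^- (2 * k + 1))
    / \det (\matrix_(h < N, t < N)
          let k := (N - t.+1)%N in
          xvar h ^+ (2 * k + 1) - xvar h ^- (2 * k + 1)).

Lemma frac_numden (R : idomainType) (f : {fraction R}) :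
  f = tofrac \n_(repr f) / tofrac \d_(repr f).
Proof.
have d0 : \d_(repr f) != 0 by exact: denom_ratioP.
apply: (canRL (mulfK _)); first by rewrite tofrac_eq0.
rewrite -{1}[f]reprK; unlock FracField.tofrac.
rewrite -[LHS]FracField.pi_mul; apply/eqmodP => /=.
rewrite FracField.equivfE /FracField.mulf !numden_Ratio ?oner_neq0 ?mulr1 //.
by rewrite mulrC.
Qed.

Lemma fsubst_frac (n : nat) (q : n.-tuple {mpoly int[n]}) :
    (forall p : {mpoly int[n]}, p \mPo q = 0 -> p = 0) ->
  forall a b : {mpoly int[n]}, b != 0 ->
  fsubst q (tofrac a / tofrac b) = tofrac (a \mPo q) / tofrac (b \mPo q).
Proof.
move=> q_inj a b b0; rewrite /fsubst; set f := tofrac a / _.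
have d0 : \d_(repr f) != 0 by exact: denom_ratioP.
have nz p : p != 0 -> tofrac (p \mPo q) != 0.
  by rewrite tofrac_eq0; apply: contra_neq => /q_inj.
have := frac_numden f; rewrite {1}/f => /eqP.
rewrite eqr_div ?tofrac_eq0 // -!tofracM tofrac_eq => /eqP e.
apply/eqP; rewrite eqr_div ?nz // -!tofracM tofrac_eq.
by rewrite -!rmorphM e.
Qed.

Lemma fsubst_zmod_morphism (n : nat) (q : n.-tuple {mpoly int[n]}) :
    (forall p : {mpoly int[n]}, p \mPo q = 0 -> p = 0) ->
  zmod_morphism (fsubst q).
Proof.
move=> q_inj f g; rewrite (frac_numden f) (frac_numden g).
have f0 : \d_(repr f) != 0 by exact: denom_ratioP.
have g0 : \d_(repr g) != 0 by exact: denom_ratioP.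
move: (\n_(repr f)) (\d_(repr f)) (\n_(repr g)) (\d_(repr g)) f0 g0.
move=> a b c d b0 d0.
have nz p : p != 0 -> tofrac (p \mPo q) != 0.
  by rewrite tofrac_eq0; apply: contra_neq => /q_inj.
rewrite -mulNr -tofracN addf_div ?tofrac_eq0 // -!tofracM -tofracD.
rewrite !fsubst_frac ?mulf_neq0 // -mulNr -tofracN addf_div ?nz //.
by rewrite -!tofracM -tofracD -comp_mpolyN -!(rmorphM (comp_mpoly q)) -comp_mpolyD.
Qed.

Lemma fsubst_monoid_morphism (n : nat) (q : n.-tuple {mpoly int[n]}) :
    (forall p : {mpoly int[n]}, p \mPo q = 0 -> p = 0) ->
  monoid_morphism (fsubst q).
Proof.
move=> q_inj; split=> [|f g].
  by rewrite -(divr1 1) -tofrac1 fsubst_frac ?oner_neq0 // !rmorph1 divr1.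
rewrite (frac_numden f) (frac_numden g).
have f0 : \d_(repr f) != 0 by exact: denom_ratioP.
have g0 : \d_(repr g) != 0 by exact: denom_ratioP.
rewrite mulf_div -!tofracM !fsubst_frac ?mulf_neq0 //.
by rewrite mulf_div -!tofracM -!(rmorphM (comp_mpoly q)).
Qed.

Lemma comp_sq_inj (n : nat) (p : {mpoly int[n]}) :
  p \mPo [tuple 'X_i ^+ 2 | i < n] = 0 -> p = 0.
Proof.
move=> /mpolyP p0; apply/mpolyP => m; have := p0 (m + m)%MM.
rewrite comp_mpolyEX mcoeff0 linear_sum /=.
have sq m1 : 'X_[m1] \mPo [tuple 'X_i ^+ 2 | i < n] = 'X_[m1 + m1] :> {mpoly int[n]}.
  rewrite comp_mpolyX mpolyXD -expr2 [X in X ^+ 2]mpolyXE_id -prodrXl.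
  by apply: eq_bigr => i _; rewrite tnth_mktuple -!exprM mulnC.
have mm m1 : ((m1 + m1 == m + m) = (m1 == m))%MM.
  apply/eqP/eqP => [/mnmP e|-> //]; apply/mnmP => i.
  by have := e i; rewrite !mnmDE !addnn => /double_inj.
under eq_bigr do rewrite linearZ /= sq mcoeffX mm.
have [mp|] := boolP (m \in msupp p); last first.
  by rewrite mcoeff_msupp negbK mcoeff0 => /eqP.
rewrite mcoeff0 (bigD1_seq m) ?msupp_uniq //= eqxx mulr1 big1 ?addr0 //.
by move=> i /negPf ->; rewrite mulr0.
Qed.

Lemma comp_opp_inj (n : nat) (p : {mpoly int[n]}) :
  p \mPo [tuple - 'X_i | i < n] = 0 -> p = 0.
Proof.
move=> p0; rewrite -[p]comp_mpoly_id.
have -> : p \mPo [tuple 'X_i | i < n]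
    = (p \mPo [tuple - 'X_i | i < n]) \mPo [tuple - 'X_i | i < n].
  rewrite [X in _ = X \mPo _]comp_mpolyEX rmorph_sum comp_mpolyEX.
  apply: eq_bigr => m _; rewrite /= comp_mpolyZ !comp_mpolyX rmorph_prod /=.
  congr (_ *: _); apply: eq_bigr => i _.
  rewrite !tnth_mktuple rmorphXn /= rmorphN /= comp_mpolyXU.
  by rewrite -tnth_nth tnth_mktuple opprK.
by rewrite p0 rmorph0.
Qed.

HB.instance Definition _ (n : nat) :=
  GRing.isZmodMorphism.Build (ratfun n) (ratfun n) (@subst_sq n)
    (fsubst_zmod_morphism (@comp_sq_inj n)).
HB.instance Definition _ (n : nat) :=
  GRing.isMonoidMorphism.Build (ratfun n) (ratfun n) (@subst_sq n)
    (fsubst_monoid_morphism (@comp_sq_inj n)).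
HB.instance Definition _ (n : nat) :=
  GRing.isZmodMorphism.Build (ratfun n) (ratfun n) (@subst_opp n)
    (fsubst_zmod_morphism (@comp_opp_inj n)).
HB.instance Definition _ (n : nat) :=
  GRing.isMonoidMorphism.Build (ratfun n) (ratfun n) (@subst_opp n)
    (fsubst_monoid_morphism (@comp_opp_inj n)).

Lemma subst_sqX (n : nat) (i : 'I_n) : subst_sq (xvar i) = xvar i ^+ 2.
Proof.
rewrite /xvar -[tofrac 'X_i]divr1 -tofrac1 /subst_sq fsubst_frac ?oner_neq0 //.
  by rewrite comp_mpolyXU -tnth_nth tnth_mktuple comp_mpoly1 tofrac1 !divr1 tofracXn.
exact: comp_sq_inj.
Qed.

Lemma subst_oppX (n : nat) (i : 'I_n) : subst_opp (xvar i) = - xvar i.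
Proof.
rewrite /xvar -[tofrac 'X_i]divr1 -tofrac1 /subst_opp fsubst_frac ?oner_neq0 //.
  by rewrite comp_mpolyXU -tnth_nth tnth_mktuple comp_mpoly1 tofrac1 !divr1 tofracN.
exact: comp_opp_inj.
Qed.

Lemma xvar_neq0 (n : nat) (i : 'I_n) : xvar i != 0.
Proof. by rewrite tofrac_eq0 -msize_poly_eq0 msizeX mdeg1. Qed.

Lemma so_exists (N : nat) (lam : seq nat) :
  exists f : ratfun N, subst_sq f == so_quotient N lam.
Proof.
pose M (e : 'I_N -> nat) : 'M[ratfun N]_N :=
  \matrix_(h, t) (xvar h ^+ e t - xvar h ^- (e t).+1).
have detM e : \det (\matrix_(h < N, t < N)
      (xvar h ^+ (2 * e t + 1) - xvar h ^- (2 * e t + 1)))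
    = (\prod_h xvar h) * subst_sq (\det (M e)).
  pose r := \row_h xvar h : 'rV[ratfun N]_N.
  have -> : \prod_h xvar h = \det (diag_mx r).
    by rewrite det_diag; apply: eq_bigr => h _; rewrite mxE.
  rewrite -det_map_mx -det_mulmx; congr (\det _).
  apply/matrixP => h t; rewrite mul_diag_mx !mxE rmorphB fmorphV !rmorphXn.
  rewrite /= subst_sqX -!exprM mulrBr -exprS addn1 mulnS add2n.
  by rewrite (exprS _ (2 * e t).+1) invfM mulVKf ?xvar_neq0.
pose e1 (t : 'I_N) := (nth 0%N lam t + (N - t.+1))%N.
pose e0 (t : 'I_N) := (N - t.+1)%N.
exists (\det (M e1) / \det (M e0)); apply/eqP.
rewrite /so_quotient (detM e1) (detM e0) fmorph_div -[RHS]mulf_div divff ?mul1r //.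
by apply/prodf_neq0 => h _; apply: xvar_neq0.
Qed.

(* The Laurent polynomial so_lam(x_1, ..., x_N) itself, i.e. the unique element *)
(* (soP, so_unique) that becomes the quotient above under x_h |-> x_h^2.       *)
Definition so (N : nat) (lam : seq nat) : ratfun N := xchoose (so_exists N lam).

Lemma soP (N : nat) (lam : seq nat) : subst_sq (so N lam) = so_quotient N lam.
Proof. exact: (eqP (xchooseP (so_exists N lam))). Qed.

Lemma so_unique (N : nat) (lam : seq nat) (f : ratfun N) :
  subst_sq f = so_quotient N lam -> f = so N lam.
Proof. by rewrite -soP => /fmorph_inj. Qed.

(* x_1, x_1^{-1}, x_2, x_2^{-1}, ..., x_n, x_n^{-1}. *)
Definition xpm (n : nat) (i : 'I_n.*2) : ratfun n :=
  let x := xvar (Ordinal (etrans (ltn_half_double i n) (ltn_ord i))) in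
  if odd i then x^-1 else x.

Lemma schur_den_neq0 (F : fieldType) (N : nat) (x : 'I_N -> F) :
  injective x -> \det (\matrix_(h < N, t < N) x h ^+ (N - t.+1)) != 0.
Proof.
move=> x_inj; set A := \matrix_(h, t) _.
have -> : A = col_perm (perm (@rev_ord_inj N)) (Vandermonde N (\row_h x h))^T.
  by apply/matrixP => h t; rewrite !mxE permE.
rewrite col_permE det_mulmx det_perm mulf_neq0 ?signr_eq0 // det_tr.
rewrite det_Vandermonde; apply/prodf_neq0 => i _; apply/prodf_neq0 => j ij.
by rewrite !mxE subr_eq0 (inj_eq x_inj) neq_ltn ij orbT.
Qed.

Lemma xpm_inj (n : nat) : injective (@xpm n).
Proof.
have X_inj : injective (@xvar n).
  move=> i j /eqP; rewrite tofrac_eq => /eqP /(congr1 (mcoeff U_(i)%MM)).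
  rewrite !mcoeffX eqxx; case: eqP => // e _; apply/esym/eqP.
  by move/mnmP/(_ i): e; rewrite !mnmE eqxx eq_sym; case: eqP.
have XV i j : xvar i != (xvar j : ratfun n)^-1.
  apply/eqP => /(congr1 ( *%R^~ (xvar j))); rewrite mulVf ?xvar_neq0 //.
  rewrite -tofracM -tofrac1 => /eqP; rewrite tofrac_eq => /eqP.
  by move/(congr1 (meval (fun=> 0))); rewrite mevalM !mevalXU meval1 mulr0.
move=> i j; rewrite /xpm; case: ifP => oi; case: ifP => oj.
- move=> /invr_inj /X_inj /(congr1 val) /= ij; apply: val_inj => /=.
  by rewrite -(odd_double_half i) -(odd_double_half j) oi oj ij.
- by move=> /esym /eqP; rewrite (negPf (XV _ _)).
- by move=> /eqP; rewrite (negPf (XV _ _)).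
- move=> /X_inj /(congr1 val) /= ij; apply: val_inj => /=.
  by rewrite -(odd_double_half i) -(odd_double_half j) oi oj ij.
Qed.

(* Main.v *)
Require Import Defs.
From mathcomp Require Import all_boot all_order all_algebra.
From mathcomp Require Import fraction.
From mathcomp.multinomials Require Import mpoly.
From mathcomp Require Import perm zify.
Import GRing.Theory.
Local Open Scope ring_scope.

(** Centred at their mean, the exponents [lam_t + 2n - t] for
    [lam = ((2m)^n)] are [+-(m + j - 1/2)], [1 <= j <= n]. Pairing the rows
    [x_i], [x_i^-1] and the opposite exponents turns the Schur numerator into
    [det [A B; B A] = det (A - B) det (A + B)] with [A = (x_i^(m+j-1/2))] and
    [B = (x_i^-(m+j-1/2))]: the first factor is the numerator of
    [so_(m^n)(x)] and the second one, up to sign, that of [so_(m^n)(-x)]. The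
    denominators are the case [m = 0], so the reordering signs cancel. *)

(** Subtracting the second block row from the first, then adding the first block column to the
    second, leaves a block lower triangular matrix. *)
Lemma det_block_symm (R : comNzRingType) (n : nat) (A B : 'M[R]_n) :
  \det (block_mx A B B A) = \det (A - B) * \det (A + B).
Proof.
have e : block_mx 1%:M (- 1%:M) 0 1%:M *m block_mx A B B A
    *m block_mx 1%:M 1%:M 0 1%:M = block_mx (A - B) 0 B (A + B).
  rewrite !mulmx_block !mulNmx !mul1mx !mul0mx !mulmx1 !mulmx0 !addr0 !add0r.
  by rewrite addrA subrK subrr [B + A]addrC.
by have := congr1 (@determinant _ _) e; rewrite !det_mulmx !det_ublock !det_lblock
  !det1 !(mul1r, mulr1).
Qed.

(** The constant is a product of two permutation signs; being independent of [M], it cancels between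
    numerator and denominator. *)
Lemma det_mxsub_inj (R : idomainType) (N N' : nat) (f g : 'I_N -> 'I_N') :
    N = N' -> injective f -> injective g ->
  exists2 c : R, c != 0 & forall M : 'M_N', \det M = c * \det (mxsub f g M).
Proof.
move=> eN; case: N' / eN f g => f g f_inj g_inj.
exists ((-1) ^+ perm f_inj * (-1) ^+ perm g_inj) => [|M].
  by rewrite mulf_neq0 ?signr_eq0.
have -> : mxsub f g M = row_perm (perm f_inj) (col_perm (perm g_inj) M).
  by apply/matrixP => i j; rewrite !mxE !permE.
rewrite row_permE col_permE !det_mulmx !det_perm odd_permV.
by rewrite [\det M * _]mulrC [_ * (_ * \det M)]mulrA [RHS]mulrA mulrACA -!signr_addb !addbb !mul1r.
Qed.

(* [pos_powers x k] and [neg_powers x k] are [x_h^(k+n-t+1/2)] and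
   [x_h^-(k+n-t+1/2)], for 1-based [t], both multiplied by [x_h^(-1/2)]. *)
Definition pos_powers {F : fieldType} {n : nat} (x : 'I_n -> F) (k : nat) :=
  \matrix_(h < n, t < n) x h ^+ (k + (n - t.+1)).

Definition neg_powers {F : fieldType} {n : nat} (x : 'I_n -> F) (k : nat) :=
  \matrix_(h < n, t < n) x h ^- (k + (n - t.+1)).+1.

(** Row [h] of both determinants loses a factor [x_h^(1/2)], which cancels in the quotient; after
    [x_h |-> x_h^2] these factors become [\prod_h xvar h]. *)
Lemma so_nseq (n m : nat) :
  so n (nseq n m) = \det (pos_powers (@xvar n) m - neg_powers (@xvar n) m)
    / \det (pos_powers (@xvar n) 0 - neg_powers (@xvar n) 0).
Proof.
apply/esym/so_unique; rewrite /so_quotient fmorph_div -!det_map_mx.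
have sq k : \det (\matrix_(h < n, t < n)
    (xvar h ^+ (2 * (k + (n - t.+1)) + 1) - xvar h ^- (2 * (k + (n - t.+1)) + 1)))
  = (\prod_h xvar h) * \det (map_mx (@subst_sq n)
      (pos_powers (@xvar n) k - neg_powers (@xvar n) k)).
  have -> : \prod_h xvar h = \det (diag_mx (\row_(h < n) xvar h)).
    by rewrite det_diag; apply: eq_bigr => h _; rewrite mxE.
  rewrite -det_mulmx; congr (\det _).
  apply/matrixP => h t; rewrite mul_diag_mx !mxE rmorphB fmorphV !rmorphXn.
  rewrite /= subst_sqX -!exprM mulrBr -exprS addn1 mulnS add2n.
  by rewrite (exprS _ (2 * (k + (n - t.+1))).+1) invfM mulVKf ?xvar_neq0.
have x0 : \prod_h @xvar n h != 0 by apply/prodf_neq0 => h _; apply: xvar_neq0.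
rewrite -[LHS]mul1r -(divff x0) mulf_div -!sq; congr (\det _ / _).
by apply/matrixP => h t; rewrite !mxE nth_nseq ltn_ord.
Qed.

(** The two exponents in an entry have opposite parities, so the difference turns into a sum, up to
    a sign that depends only on the column. *)
Lemma subst_opp_det (n k : nat) :
  subst_opp (\det (pos_powers (@xvar n) k - neg_powers (@xvar n) k))
  = (-1) ^+ (k * n) * (\prod_(t < n) (-1) ^+ (n - t.+1))
    * \det (pos_powers (@xvar n) k + neg_powers (@xvar n) k).
Proof.
have -> : (-1) ^+ (k * n) * \prod_(t < n) (-1) ^+ (n - t.+1)
    = \det (diag_mx (\row_(t < n) (-1) ^+ (k + (n - t.+1)))) :> ratfun n.
  rewrite det_diag; under [RHS]eq_bigr do rewrite mxE exprD.
  by rewrite big_split /= prodr_const card_ord -exprM.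
rewrite mulrC -det_mulmx -det_map_mx; congr (\det _).
apply/matrixP => h t; rewrite mul_mx_diag !mxE rmorphB fmorphV !rmorphXn /=.
rewrite subst_oppX; set e := (_ + _)%N.
rewrite !(exprNn (xvar h)) invfM -exprVn invrN1 exprS mulN1r mulNr opprK -mulrDr.
by rewrite mulrC.
Qed.

Lemma xpm_half (n : nat) (i : 'I_n.*2) (h : 'I_n) :
  i./2 = h :> nat -> xpm i = if odd i then (xvar h)^-1 else xvar h.
Proof.
move=> ih; rewrite /xpm; congr (if _ then (xvar _)^-1 else xvar _);
  exact: val_inj.
Qed.

Lemma schur_mx_det (n : nat) : exists2 c : ratfun n, c != 0 & forall m : nat,
  \det (\matrix_(h < n.*2, t < n.*2)
      xpm h ^+ (nth 0%N (nseq n (2 * m)) t + (n.*2 - t.+1)))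
  = c * (\det (pos_powers (@xvar n) m - neg_powers (@xvar n) m)
         * \det (pos_powers (@xvar n) m + neg_powers (@xvar n) m)).
Proof.
have f_lt (i : 'I_(n + n)) : ((if i < n then i.*2 else (i - n).*2.+1) < n.*2)%N.
  by case: i => i /= ?; case: ifP; lia.
have g_lt (i : 'I_(n + n)) : ((if i < n then i : nat else n.*2 - (i - n).+1) < n.*2)%N.
  by case: i => i /= ?; case: ifP; lia.
(* [f] lists all [x_h] before all [x_h^-1]; [g] reverses the last [n] columns, so that columns [t]
   and [n + t] have opposite centred exponents. *)
pose f i := Ordinal (f_lt i); pose g i := Ordinal (g_lt i).
have f_inj : injective f.
  case=> i ? [j ?] /(congr1 val) /= e; apply: val_inj => /=.
  by move: e; case: ifP; case: ifP; lia.
have g_inj : injective g.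
  case=> i ? [j ?] /(congr1 val) /= e; apply: val_inj => /=.
  by move: e; case: ifP; case: ifP; lia.
have [c c0 detE] := @det_mxsub_inj (ratfun n) _ _ f g (addnn n) f_inj g_inj.
(* The rescalings of rows [x_h] and [x_h^-1] multiply to [x_h], whatever [m] is. *)
exists (c * \prod_(h < n) xvar h) => [|m].
  by rewrite mulf_neq0 //; apply/prodf_neq0 => h _; apply: xvar_neq0.
rewrite detE -mulrA; congr (_ * _).
(* [r] recentres the exponents at 0, up to the factor [x_h^(-1/2)] above. *)
pose r := row_mx (\row_(h < n) (xvar h ^+ (m + n)))
                 (\row_(h < n) (xvar h * xvar h ^- (m + n))).
have -> : \prod_(h < n) xvar h = \det (diag_mx r).
  rewrite det_diag big_split_ord /= -big_split /=; apply: eq_bigr => h _.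
  by rewrite row_mxEl row_mxEr !mxE mulrCA mulfV ?mulr1 ?expf_neq0 ?xvar_neq0.
rewrite -det_block_symm -det_mulmx; congr (\det _).
apply/matrixP => i j; rewrite mul_diag_mx [LHS]mxE [LHS]mxE [RHS]mxE.
have f_l (h : 'I_n) : xpm (f (lshift n h)) = xvar h.
  by rewrite (@xpm_half _ _ h) /= ltn_ord ?odd_double ?doubleK.
have f_r (h : 'I_n) : xpm (f (rshift n h)) = (xvar h)^-1.
  rewrite (@xpm_half _ _ h) /= ltnNge leq_addr /= addKn ?odd_double //.
  by rewrite uphalf_double.
have g_l (t : 'I_n) : (nth 0 (nseq n (2 * m)) (g (lshift n t)) +
    (n.*2 - (g (lshift n t)).+1) = (m + n) + (m + (n - t.+1)))%N.
  by rewrite nth_nseq /= !ltn_ord; have := ltn_ord t; lia.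
(* These columns lie past the [n] parts, where the padding gives 0. *)
have g_r (t : 'I_n) : (nth 0 (nseq n (2 * m)) (g (rshift n t)) +
    (n.*2 - (g (rshift n t)).+1) = t)%N.
  rewrite nth_nseq /= [(n + t < n)%N]ltnNge leq_addr /= addKn.
  by have := ltn_ord t; case: ifP; lia.
have dec (t : 'I_n) : (m + n = t + (m + (n - t.+1)).+1)%N.
  by have := ltn_ord t; lia.
case: (split_ordP i) => h ->; case: (split_ordP j) => t -> {i j};
  rewrite ?f_l ?f_r ?g_l ?g_r.
- by rewrite block_mxEul row_mxEl !mxE exprD.
- rewrite block_mxEur row_mxEl !mxE {1}(dec t) exprD.
  by rewrite mulfK ?expf_neq0 ?xvar_neq0.
- rewrite block_mxEdl row_mxEr !mxE exprVn exprD exprS !invfM.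
  by rewrite mulrACA mulfV ?xvar_neq0 // mul1r.
- rewrite block_mxEdr row_mxEr !mxE exprVn {1}(dec t) exprD exprS.
  by rewrite mulrAC invfM mulrC mulfVK ?mulf_neq0 ?expf_neq0 ?xvar_neq0.
Qed.

Theorem theorem1 (m n : nat) :
  schur (nseq n (2 * m)%N) (@xpm n)
  = (-1) ^+ (m * n) * so n (nseq n m) * subst_opp (so n (nseq n m)).
Proof.
have [c c0 detE] := schur_mx_det n.
have den : \det (\matrix_(h < n.*2, t < n.*2) xpm h ^+ (n.*2 - t.+1))
    = \det (\matrix_(h < n.*2, t < n.*2)
        xpm h ^+ (nth 0%N (nseq n (2 * 0)) t + (n.*2 - t.+1))) :> ratfun n.
  by congr (\det _); apply/matrixP => h t; rewrite !mxE nth_nseq if_same.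
rewrite /schur den !detE -mulf_div divff // mul1r so_nseq fmorph_div /=.
rewrite !subst_opp_det mul0n mul1r.
(* This sign does not depend on [m], so it cancels; only [(-1)^(mn)] survives, and it squares to 1
   with the prefactor. *)
set p := \prod_(t < n) _.
have p0 : p != 0 by apply/prodf_neq0 => t _; rewrite signr_eq0.
rewrite -[_ * p * _]mulrA -[_ * _ / (p * _)]mulrA -!mulf_div divff // mul1r.
by rewrite [RHS]mulrACA -expr2 sqrr_sign mul1r.
Qed.
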